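(* Let $\mathbf{X}=\{X_1,\dots,X_K\}$ be real-valued random variables whose joint CDF is represented by a cumulative distribution network, $F(\mathbf{x})=\prod_{c\in\mathcal{C}}\phi_c(\mathbf{x}_c)$. Let $\mathbf{X}_s,\mathbf{X}_t\subseteq\mathbf{X}$ be two disjoint sets of variables. If there is no cumulative function connecting variable nodes in $\mathbf{X}_s$ and $\mathbf{X}_t$, i.e. there is no $c\in\mathcal{C}$ with $\mathbf{X}_c\cap\mathbf{X}_s\neq\emptyset$ and $\mathbf{X}_c\cap\mathbf{X}_t\neq\emptyset$, then $\mathbf{X}_s$ and $\mathbf{X}_t$ are marginally independent: $\mathbf{X}_s\perp\!\!\!\perp\mathbf{X}_t$.
   Context: Let $\mathbf{X}=\{X_1,\dots,X_K\}$ be real-valued random variables with joint cumulative distribution function (CDF) $F(\mathbf{x})=\Pr\{X_1\le x_1,\dots,X_K\le x_K\}$, $\mathbf{x}=(x_1,\dots,x_K)$. It is assumed that a joint PDF exists (a density if the variables are continuous, a probability mass function if they are discrete). A cumulative distribution network (CDN) for $\mathbf{X}$ is a bipartite undirected graph with variable nodes $X_1,\dots,X_K$ and finitely many function nodes $c\in\mathcal{C}$. Each function node $c$ carries a function $\phi_c(\mathbf{x}_c)$ of the values $\mathbf{x}_c$ of a subset $\mathbf{X}_c\subseteq\mathbf{X}$, and $c$ is joined by an edge exactly to the variables in $\mathbf{X}_c$. The joint CDF of $\mathbf{X}$ is $F(\mathbf{x})=\prod_{c\in\mathcal{C}}\phi_c(\mathbf{x}_c)$. The functions satisfy $\phi_c(\mathbf{x}_c)\ge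 0$ and $\sup_{\mathbf{x}_c}\phi_c(\mathbf{x}_c)=1$ for every $c\in\mathcal{C}$. *)

(* Defs.v *)
From HB Require Import structures.
From mathcomp Require Import all_boot all_order all_algebra.
From mathcomp Require Import all_classical all_reals all_analysis.

Set Implicit Arguments.
Unset Strict Implicit.
Unset Printing Implicit Defensive.

Import Order.TTheory GRing.Theory Num.Theory.
Import numFieldNormedType.Exports.

Local Open Scope classical_set_scope.
Local Open Scope ring_scope.

(* The subvector x_S of x, its coordinates listed in increasing order. *)
Definition subvec (R : Type) (K : nat) (S : {set 'I_K}) (x : K.-tuple R) :
    #|S|.-tuple R :=
  [tuple tnth x (enum_val i) | i < #|S|].

(* The bipartite graph is given by the function nodes and their neighbourhoods:
   i \in cdn_scope c means that X_i and c are joined by an edge.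
   [sup] is 0 on sets without an upper bound, so cdn_fun_sup1 also says that
   the range of cdn_fun c is bounded above. *)
Record cdn (R : realType) (K : nat) := CDN {
  cdn_node : finType;
  cdn_scope : cdn_node -> {set 'I_K};
  cdn_fun : forall c : cdn_node, #|cdn_scope c|.-tuple R -> R;
  cdn_fun_ge0 : forall c y, 0 <= @cdn_fun c y;
  cdn_fun_sup1 : forall c, sup (range (@cdn_fun c)) = 1
}.

Section random_vectors.
Context d (Omega : measurableType d) (R : realType) (P : probability Omega R).
Context (K : nat).
Implicit Types (X : 'I_K -> {RV P >-> R}) (S T : {set 'I_K}).

Definition rvec X (w : Omega) : K.-tuple R := [tuple X i w | i < K].

Definition joint_cdf X (x : K.-tuple R) : \bar R :=
  P [set w | forall i, X i w <= tnth x i].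

(* For nonnegative measurable f this is, by Tonelli, the integral of f with
   respect to n-dimensional Lebesgue measure. *)
Fixpoint iterated_integral (n : nat) : (n.-tuple R -> \bar R) -> \bar R :=
  match n with
  | 0 => fun f => f [tuple]
  | m.+1 => fun f => (\int[@lebesgue_measure R]_x
                iterated_integral (fun t : m.-tuple R => f [tuple of x :: t]))%E
  end.

Definition is_joint_density X (f : K.-tuple R -> R) : Prop :=
  [/\ measurable_fun setT f,
      forall x, 0 <= f x
    & forall A : set (K.-tuple R), measurable A ->
        P (rvec X @^-1` A) =
        iterated_integral (fun x => (f x * \1_A x)%:E)].

Definition is_joint_pmf X (p : K.-tuple R -> R) : Prop :=
  (forall x, 0 <= p x) /\
  forall A : set (K.-tuple R), measurable A ->
    P (rvec X @^-1` A) = \esum_(x in A) (p x)%:E.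

Definition has_joint_pdf X : Prop :=
  (exists f, is_joint_density X f) \/ (exists p, is_joint_pmf X p).

Definition represented_by X (G : cdn R K) : Prop :=
  forall x : K.-tuple R,
    joint_cdf X x =
    (\prod_(c : cdn_node G) cdn_fun (subvec (cdn_scope c) x))%:E.

(* A and B range over the Borel sets of R^#|S| and R^#|T|. *)
Definition marginally_independent X S T : Prop :=
  forall (A : set (#|S|.-tuple R)) (B : set (#|T|.-tuple R)),
    measurable A -> measurable B ->
    let X_S := subvec S \o rvec X in
    let X_T := subvec T \o rvec X in
    P (X_S @^-1` A `&` X_T @^-1` B) = (P (X_S @^-1` A) * P (X_T @^-1` B))%E.

End random_vectors.

(* Main.v *)
Require Import Defs.
From HB Require Import structures.
From mathcomp Require Import all_boot all_order all_algebra.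
From mathcomp Require Import all_classical all_reals all_analysis.

Set Implicit Arguments.
Unset Strict Implicit.
Unset Printing Implicit Defensive.

Import Order.TTheory GRing.Theory Num.Theory.

Local Open Scope ring_scope.

(* Write H for the product of the functions of the network, and for a set U of
   indices let x^U_n be x with every coordinate outside U replaced by n.  Since
   no scope meets both S and T, each function node takes the same value at
   x^(S u T)_n as at one of x^S_n, x^T_n, and the same value at x^0_n as at the
   other, whence
     H(x^(S u T)_n) H(x^0_n) = H(x^S_n) H(x^T_n).
   As n tends to infinity these four factors tend to the marginal CDFs on
   S u T, on the empty set (that is, 1), on S and on T.  So the joint CDF of
   (X_S, X_T) factors, and as the lower orthants form a pi-system generating the
   Borel sets, X_S and X_T are independent. *)

(** * Lower orthants as a pi-system generating the Borel sets *)

Section orthants.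
Context (R : realType) (n : nat).
Local Open Scope classical_set_scope.

Definition orthant (x : n.-tuple R) : set (n.-tuple R) :=
  [set t | forall i, tnth t i <= tnth x i].

Lemma orthant_bigcap (x : n.-tuple R) : orthant x =
  \bigcap_(i in [set: 'I_n]) ((@tnth n R)^~ i @^-1` `]-oo, tnth x i]).
Proof.
apply/seteqP; split => t /= tx i; first by move=> _ /=; rewrite in_itv/= tx.
by have := tx i I; rewrite /= in_itv.
Qed.

Lemma measurable_orthant (x : n.-tuple R) : measurable (orthant x).
Proof.
rewrite orthant_bigcap; apply: fin_bigcap_measurable => // i _.
by rewrite -[X in measurable X]setTI; apply: measurable_tnth.
Qed.

Lemma setI_closed_orthant : setI_closed (range orthant).
Proof.
move=> _ _ [x _ <-] [y _ <-].
exists [tuple Num.min (tnth x i) (tnth y i) | i < n] => //.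
apply/seteqP; split => t /=.
  by move=> txy; split => i; have := txy i;
    rewrite tnth_mktuple le_min => /andP[].
by move=> [tx ty] i; rewrite tnth_mktuple le_min tx ty.
Qed.

Lemma tuple_ubound_nat (t : n.-tuple R) :
  exists k : nat, forall i, tnth t i <= k%:R.
Proof.
(* Truncation rounds down, so the successor is what bounds every coordinate. *)
exists (\max_(i < n) Num.truncn `|tnth t i|).+1 => i.
rewrite (le_trans (ler_norm _))// (le_trans (ltW (truncnS_gt _)))//.
by rewrite ler_nat ltnS (leq_bigmax i).
Qed.

Lemma bigcup_orthant_nat : \bigcup_k orthant [tuple k%:R | i < n] = setT.
Proof.
apply/seteqP; split => // t _; have [k tk] := tuple_ubound_nat t.
by exists k => // i; rewrite tnth_mktuple.
Qed.

(** The product sigma-algebra is generated by coordinate conditions, and a condition [tnth t i <= r]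
    is a countable union of orthants: bound the other coordinates by [k] and let [k] grow. *)
Lemma measurable_tuple_orthantE :
  @measurable _ (n.-tuple R) = <<s range orthant >>.
Proof.
apply/seteqP; split; last first.
  apply: smallest_sub; first exact: sigma_algebra_measurable.
  by move=> _ [x _ <-]; exact: measurable_orthant.
apply: smallest_sub; first exact: smallest_sigma_algebra.
rewrite -bigcup_seq => A [i /= _ [B mB <-]].
have /seteqP[/(_ _ mB) {}mB _] := measurable_realfun.RGenOInfty.measurableE R.
(* The sets whose preimage under the [i]-th coordinate lies in [<<s range orthant >>] form a
   sigma-algebra, so only open upper rays, complements of closed lower rays, need checking. *)
suff : <<s @measurable_realfun.RGenOInfty.G R >> `<=`
    image_set_system setT (fun t : n.-tuple R => tnth t i) <<s range orthant >>.
  exact.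
apply: smallest_sub.
  by apply: sigma_algebra_image; exact: smallest_sigma_algebra.
move=> _ [r ->]; rewrite /image_set_system/= setTI -setCitvl preimage_setC.
rewrite -setTD; apply: sigma_algebraCD.
rewrite (_ : (fun t => _) =
    \bigcup_k orthant [tuple (if j == i then r else k%:R) | j < n]).
  by apply: sigma_algebra_bigcup => k; apply: sub_sigma_algebra; eexists.
apply/seteqP; split => t; rewrite /= in_itv/=.
  move=> tr; have [k tk] := tuple_ubound_nat t.
  by exists k => // j; rewrite tnth_mktuple; case: eqP => // ->.
by move=> [k _ /(_ i)]; rewrite tnth_mktuple eqxx.
Qed.

End orthants.

(** * Independence from a generating pi-system *)

Section independence.
Context d (Omega : measurableType d) (R : realType) (P : probability Omega R).
Local Open Scope classical_set_scope.
Local Open Scope ereal_scope.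

(** Both sides are finite measures in [A]: the law of [f] under [P] restricted to [E], and the law
    of [f] scaled by [P E]. They agree on a pi-system with a countable cover, hence everywhere. *)
Lemma indep_preimage_generated d' (T : measurableType d') (f : Omega -> T)
    (mf : measurable_fun setT f) (G : set (set T)) (g : (set T)^nat)
    (mG : measurable = <<s G >>) (setIG : setI_closed G)
    (Gg : forall i, G (g i)) (g_cover : \bigcup_k g k = setT)
    (E : set Omega) (mE : measurable E) :
  (forall A, G A -> P (f @^-1` A `&` E) = P (f @^-1` A) * P E) ->
  forall A, measurable A -> P (f @^-1` A `&` E) = P (f @^-1` A) * P E.
Proof.
move=> PG A mA.
have PE0 : (0 <= fine (P E))%R by rewrite fine_ge0.
pose r : {nonneg R} := NngNum PE0.
have rE : r%:num%:E = P E by rewrite /= fineK ?fin_num_measure.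
pose m1 : {measure set T -> \bar R} := pushforward (mrestr P mE) f.
pose m2 : {measure set T -> \bar R} := mscale r (pushforward P f).
suff : m1 mf A = m2 mf A by rewrite /m1 /m2 /= /mscale /pushforward rE muleC.
apply: (measure_unique G g) => // [B GB|k].
  by rewrite /m1 /m2 /= /mscale /pushforward rE muleC; exact: PG.
rewrite /m1 /= /pushforward /mrestr.
rewrite ltey_eq fin_num_measure//; apply: measurableI => //.
rewrite -[X in measurable X]setTI; apply: mf => //.
by rewrite mG; exact: sub_sigma_algebra.
Qed.

Lemma indep_of_orthant m n (f : Omega -> m.-tuple R) (g : Omega -> n.-tuple R) :
  measurable_fun setT f -> measurable_fun setT g ->
  (forall a b, P (f @^-1` orthant a `&` g @^-1` orthant b) =
               P (f @^-1` orthant a) * P (g @^-1` orthant b)) ->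
  forall A B, measurable A -> measurable B ->
    P (f @^-1` A `&` g @^-1` B) = P (f @^-1` A) * P (g @^-1` B).
Proof.
move=> mf mg fg A B mA mB.
have mfA : measurable (f @^-1` A) by rewrite -[X in measurable X]setTI; exact: mf.
(* One factor is extended at a time: first [B], against the fixed event [f @^-1]
   A[; then, for each orthant]b[, the set]A[, against]g @^-1[orthant b]. *)
rewrite setIC muleC.
apply: (indep_preimage_generated mg (@measurable_tuple_orthantE R n)
  (@setI_closed_orthant R n) _ (@bigcup_orthant_nat R n)) => //.
move=> _ [b _ <-]; rewrite setIC muleC.
have mgb : measurable (g @^-1` orthant b).
  by rewrite -[X in measurable X]setTI; apply: mg => //; exact: measurable_orthant.
apply: (indep_preimage_generated mf (@measurable_tuple_orthantE R m)
  (@setI_closed_orthant R m) _ (@bigcup_orthant_nat R m)) => //.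
by move=> _ [a _ <-].
Qed.

End independence.

(** * Restricting and gluing vectors *)

Section subvectors.
Context (R : Type) (K : nat).
Implicit Types (S T : {set 'I_K}) (x y : K.-tuple R).

Lemma eq_subvec S x y :
  (forall i, i \in S -> tnth x i = tnth y i) -> subvec S x = subvec S y.
Proof.
move=> xy; apply: eq_from_tnth => i; rewrite !tnth_mktuple.
exact/xy/enum_valP.
Qed.

(** This lets a pair of orthants be described by one point of the full space. By disjointness no
    coordinate is prescribed twice; those outside both sets receive the default [r], their index
    being past the end of [b]. *)
Lemma subvec_glue (r : R) S T (a : #|S|.-tuple R) (b : #|T|.-tuple R) :
  [disjoint S & T] -> exists x, subvec S x = a /\ subvec T x = b.
Proof.
move=> ST.
exists [tuple if i \in S then nth r a (index i (enum S))
        else nth r b (index i (enum T)) | i < K].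
split; apply: eq_from_tnth => i; rewrite !tnth_mktuple.
  rewrite enum_valP (tnth_nth r) (enum_val_nth (enum_val i)) index_uniq//.
    by rewrite -cardE.
  exact: enum_uniq.
rewrite (disjointFl ST (enum_valP i)).
rewrite (tnth_nth r) (enum_val_nth (enum_val i)) index_uniq//.
  by rewrite -cardE.
exact: enum_uniq.
Qed.

End subvectors.

(** * Marginal CDFs as limits of the joint CDF *)

Section marginal_cdf.
Context d (Omega : measurableType d) (R : realType) (P : probability Omega R).
Context (K : nat) (X : 'I_K -> {RV P >-> R}).
Implicit Types (S T U : {set 'I_K}) (x : K.-tuple R).
Local Open Scope classical_set_scope.

Definition marginal_event U x : set Omega :=
  [set w | forall i, i \in U -> X i w <= tnth x i].

(** The point written x^U_n above; the bounds outside [U] become void as [n] grows. *)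
Definition free_outside U x (n : nat) : K.-tuple R :=
  [tuple if i \in U then tnth x i else n%:R | i < K].

Lemma preimage_subvec_orthant U x :
  (subvec U \o rvec X) @^-1` orthant (subvec U x) = marginal_event U x.
Proof.
apply/seteqP; split => w /= wx i.
  move=> iU; have := wx (enum_rank_in iU i).
  by rewrite !tnth_mktuple enum_rankK_in.
by rewrite !tnth_mktuple; exact/wx/enum_valP.
Qed.

Lemma marginal_eventU S T x :
  marginal_event (S :|: T) x = marginal_event S x `&` marginal_event T x.
Proof.
apply/seteqP; split => w /=.
  by move=> wx; split => i iU; apply: wx; rewrite finset.inE iU ?orbT.
by move=> [wS wT] i; rewrite finset.inE => /orP[/wS|/wT].
Qed.

Lemma measurable_subvec_rvec U : measurable_fun setT (subvec U \o rvec X).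
Proof.
apply/measurable_fun_tnthP => i.
rewrite (_ : _ \o _ = X (enum_val i)) //.
by apply/funext => w /=; rewrite !tnth_mktuple.
Qed.

Lemma measurable_marginal_event U x : measurable (marginal_event U x).
Proof.
rewrite -preimage_subvec_orthant -[X in measurable X]setTI.
by apply: measurable_subvec_rvec => //; exact: measurable_orthant.
Qed.

Lemma joint_cdf_free_outside U x n :
  joint_cdf X (free_outside U x n) =
  P (marginal_event [set: 'I_K]%SET (free_outside U x n)).
Proof.
congr (P _); apply/seteqP; split => w /= wx i; first by move=> _; exact: wx.
exact/wx/finset.in_setT.
Qed.

(** Continuity of [P] from below: the events increase with [n], and their union is the marginal
    event because each outcome has finitely many real coordinates, all below some natural number. *)
Lemma cvg_joint_cdf_free_outside U x :
  (joint_cdf X (free_outside U x n) @[n --> \oo] --> P (marginal_event U x))%classic.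
Proof.
pose F n := marginal_event [set: 'I_K]%SET (free_outside U x n).
have FU : \bigcup_n F n = marginal_event U x.
  apply/seteqP; split => w /=.
    move=> [n _ wn] i iU.
    by have := wn i (finset.in_setT _); rewrite tnth_mktuple iU.
  move=> wx; have [k wk] := tuple_ubound_nat (rvec X w).
  exists k => // i _; rewrite tnth_mktuple; case: ifPn => [/wx//|_].
  by have := wk i; rewrite tnth_mktuple.
rewrite -FU (_ : (fun n => _) = P \o F); last first.
  by apply/funext => n /=; exact: joint_cdf_free_outside.
apply: nondecreasing_cvg_mu => [n||n m nm].
- exact: measurable_marginal_event.
- by rewrite FU; exact: measurable_marginal_event.
- apply/subsetPset => w wn i iT; apply: (le_trans (wn i iT)).
  by rewrite !tnth_mktuple; case: ifP; rewrite // ler_nat.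
Qed.

(** Only membership on the scope matters. If it misses [S], then [S :|: T] acts there as [T] and the
    empty set as [S]; if it misses [T], the roles are exchanged. *)
Lemma cdn_fun_free_outside_cross (G : cdn R K) S T x n (c : cdn_node G) :
  cdn_scope c :&: S = finset.set0 \/ cdn_scope c :&: T = finset.set0 ->
  let phi U := cdn_fun (subvec (cdn_scope c) (free_outside U x n)) in
  phi (S :|: T) * phi finset.set0 = phi S * phi T.
Proof.
move=> cST phi.
have phi_eq (U V : {set 'I_K}) : {in cdn_scope c, U =i V} -> phi U = phi V.
  move=> UV; congr (cdn_fun _); apply: eq_subvec => i /UV.
  by rewrite !tnth_mktuple => ->.
have out (V : {set 'I_K}) i : cdn_scope c :&: V = finset.set0 -> i \in cdn_scope c ->
    (i \in V) = false.
  by move=> /finset.setP/(_ i); rewrite !finset.inE => + ic; rewrite ic.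
case: cST => cV; first rewrite mulrC.
all: by congr (_ * _); apply: phi_eq => i ic;
  rewrite !finset.inE (out _ _ cV ic) ?orbF.
Qed.

Lemma marginal_event_indep (G : cdn R K) S T x :
  represented_by X G ->
  (forall c : cdn_node G,
    cdn_scope c :&: S = finset.set0 \/ cdn_scope c :&: T = finset.set0) ->
  P (marginal_event S x `&` marginal_event T x) =
  (P (marginal_event S x) * P (marginal_event T x))%E.
Proof.
move=> XG sep; rewrite -marginal_eventU.
pose F U n := joint_cdf X (free_outside U x n).
have cvgF U : F U n @[n --> \oo] --> P (marginal_event U x).
  exact: cvg_joint_cdf_free_outside.
have finP U : P (marginal_event U x) \is a fin_num.
  exact/fin_num_measure/measurable_marginal_event.
have P0 : P (marginal_event finset.set0 x) = 1%E.
  rewrite (_ : marginal_event _ _ = setT) ?probability_setT//.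
  by apply/seteqP; split => // w _ i; rewrite finset.inE.
have cross : (fun n => F (S :|: T) n * F finset.set0 n)%E =
             (fun n => F S n * F T n)%E.
  apply/funext => n; rewrite /F !XG -!EFinM -!big_split/=; congr (_ %:E).
  by apply: eq_bigr => c _; exact: cdn_fun_free_outside_cross.
(* Finiteness of the limits rules out the indeterminate product of zero and infinity. By [cross] the
   same sequence has two limits, which must coincide. *)
have lST := cvgeM (mule_def_fin (finP (S :|: T)) (finP finset.set0))
  (cvgF (S :|: T)) (cvgF finset.set0).
rewrite cross P0 mule1 in lST.
rewrite -(cvg_lim (@ereal_hausdorff R) (lST _)).
apply: (cvg_lim (@ereal_hausdorff R)).
exact: cvgeM (mule_def_fin (finP S) (finP T)) (cvgF S) (cvgF T).
Qed.

End marginal_cdf.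

Theorem mainTheorem1 (d : measure_display) (Omega : measurableType d)
  (R : realType) (P : probability Omega R) (K : nat)
  (X : 'I_K -> {RV P >-> R}) (hpdf : has_joint_pdf X)
  (G : cdn R K) (hG : represented_by X G)
  (S T : {set 'I_K}) (hST : [disjoint S & T])
  (hsep : ~ exists c : cdn_node G,
      cdn_scope c :&: S != finset.set0 /\ cdn_scope c :&: T != finset.set0) :
  marginally_independent X S T.
Proof.
move=> A B mA mB; apply: indep_of_orthant => //.
- exact: measurable_subvec_rvec.
- exact: measurable_subvec_rvec.
move=> a b; have [x [<- <-]] := subvec_glue 0 a b hST.
rewrite !preimage_subvec_orthant.
apply: (marginal_event_indep x hG) => c.
have [|cS] := eqVneq (cdn_scope c :&: S) finset.set0; first by left.
right; apply/eqP; apply: contra_notT hsep => cT; by exists c.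
Qed.
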